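(* Let $M \in [0,+\infty]$, let $I$ be a finite nonempty index set, and let $A_I=\{(x_i,y_i,g^x_i,g^y_i,f_i)\}_{i\in I}$ with $x_i,g^x_i\in\mathbb{R}^{d_x}$, $y_i,g^y_i\in\mathbb{R}^{d_y}$, $f_i\in\mathbb{R}$. Then $A_I$ is $\mathcal{S}^{Lip}_M$-interpolable if and only if both of the following conditions hold: $$f_i \geq f_j + \langle g^x_j, x_i-x_j\rangle + \langle g^y_i, y_i-y_j\rangle \quad \text{for all } i,j\in I,$$ $$\|g^x_i\|_2\leq M,\qquad \|g^y_i\|_2\leq M \quad \text{for all } i\in I.$$
   Context: $\langle\cdot,\cdot\rangle$ and $\|\cdot\|_2$ are the standard inner product and Euclidean norm. A function $f:\mathbb{R}^{d_x}\times\mathbb{R}^{d_y}\to\mathbb{R}$ is convex--concave ($f\in\mathcal{S}$) if $f(\cdot,y)$ is convex for every $y$ and $f(x,\cdot)$ is concave for every $x$. For $M\in[0,+\infty]$, $\mathcal{S}^{Lip}_M$ is the set of $f\in\mathcal{S}$ with $$|f(x_1,y_1)-f(x_0,y_0)|\leq M(\|x_1-x_0\|_2+\|y_1-y_0\|_2)\quad\text{for all } x_0,x_1\in\mathbb{R}^{d_x},\ y_0,y_1\in\mathbb{R}^{d_y}.$$ The value $M=+\infty$ is allowed, in which case the Lipschitz condition is vacuous ($\mathcal{S}^{Lip}_{+\infty}=\mathcal{S}$) and the norm bounds are vacuous. Here $\partial_x f(x,y)$ is the subdifferential of the convex function $f(\cdot,y)$ at $x$, and $\partial_y f(x,y)$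 is the superdifferential of the concave function $f(x,\cdot)$ at $y$, i.e. the set of $g$ with $f(x,y')\leq f(x,y)+\langle g,y'-y\rangle$ for all $y'$. For a class $\mathcal{C}$ of convex--concave functions, $A_I$ is $\mathcal{C}$-interpolable if there exists $f\in\mathcal{C}$ such that $g^x_i\in\partial_x f(x_i,y_i)$, $g^y_i\in\partial_y f(x_i,y_i)$ and $f_i=f(x_i,y_i)$ for all $i\in I$. *)

(* Defs.v *)
From HB Require Import structures.
From mathcomp Require Import all_boot all_order all_algebra.
From mathcomp Require Import boolp classical_sets reals constructive_ereal convex.

Set Implicit Arguments.
Unset Strict Implicit.
Unset Printing Implicit Defensive.

Import Order.TTheory GRing.Theory Num.Theory.

Local Open Scope classical_set_scope.
Local Open Scope ring_scope.

Definition dotp (R : realType) (d : nat) (u v : 'rV[R]_d) : R :=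
  \sum_(k < d) u 0 k * v 0 k.

(* The library norm `|u| on 'rV[R]_d is the maximum norm, hence this one. *)
Definition norm2 (R : realType) (d : nat) (u : 'rV[R]_d) : R :=
  Num.sqrt (dotp u u).

Definition concave_function (R : realType) (d : nat)
    (D : set 'rV[R]_d) (f : 'rV[R]_d -> R) : Prop :=
  convex_function (D : set (convex_lmodType 'rV[R]_d)) (fun u => - f u : R^o).

Definition subdifferential (R : realType) (d : nat) (f : 'rV[R]_d -> R)
    (u : 'rV[R]_d) : set 'rV[R]_d :=
  [set g | forall v, f u + dotp g (v - u) <= f v].

Definition superdifferential (R : realType) (d : nat) (f : 'rV[R]_d -> R)
    (u : 'rV[R]_d) : set 'rV[R]_d :=
  [set g | forall v, f v <= f u + dotp g (v - u)].

Definition partial_x (R : realType) (dx dy : nat)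
    (f : 'rV[R]_dx -> 'rV[R]_dy -> R) (x : 'rV[R]_dx) (y : 'rV[R]_dy) :
    set 'rV[R]_dx :=
  subdifferential (fun x' => f x' y) x.

Definition partial_y (R : realType) (dx dy : nat)
    (f : 'rV[R]_dx -> 'rV[R]_dy -> R) (x : 'rV[R]_dx) (y : 'rV[R]_dy) :
    set 'rV[R]_dy :=
  superdifferential (fun y' => f x y') y.

Definition convex_concave (R : realType) (dx dy : nat) :
    set ('rV[R]_dx -> 'rV[R]_dy -> R) :=
  [set f | (forall y, convex_function
                        (setT : set (convex_lmodType 'rV[R]_dx))
                        (fun x => f x y : R^o))
        /\ (forall x, concave_function setT (f x))].

(* For M = +oo the bound is vacuous: its right-hand side is +oo, unless
   (x1, y1) = (x0, y0), where +oo * 0 = 0 and the left-hand side is 0 too. *)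
Definition lip_convex_concave (R : realType) (dx dy : nat) (M : \bar R) :
    set ('rV[R]_dx -> 'rV[R]_dy -> R) :=
  [set f | convex_concave f /\
    forall (x0 x1 : 'rV[R]_dx) (y0 y1 : 'rV[R]_dy),
      (`|f x1 y1 - f x0 y0|%:E
        <= M * (norm2 (x1 - x0) + norm2 (y1 - y0))%:E)%E].

Definition interpolable (R : realType) (dx dy : nat)
    (C : set ('rV[R]_dx -> 'rV[R]_dy -> R)) (I : Type)
    (x : I -> 'rV[R]_dx) (y : I -> 'rV[R]_dy)
    (gx : I -> 'rV[R]_dx) (gy : I -> 'rV[R]_dy) (fv : I -> R) : Prop :=
  exists f, C f /\
    forall i, [/\ partial_x f (x i) (y i) (gx i),
                  partial_y f (x i) (y i) (gy i) &
                  fv i = f (x i) (y i)].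

(* Main.v *)
Require Import Defs.
From mathcomp Require Import all_boot all_order all_algebra.
From mathcomp Require Import boolp classical_sets reals constructive_ereal.
From mathcomp Require Import interval_inference convex ring lra.

Import Order.TTheory GRing.Theory Num.Theory.

Local Open Scope ring_scope.

(** Sufficiency: choose a finite [m <= M] bounding the norms of all the given
    gradients and put
      f(u, v) = sup_l [sum_i l_i (f_i + <gx_i, u - x_i>)
                       - m |v - sum_i l_i y_i|],
    where [l] ranges over the probability simplex on [I]. As a supremum of affine
    functions of [u], [f] is convex in [u]; as a partial supremum of a jointly
    concave function of [(l, v)], it is concave in [v]; and it is
    [m]-Lipschitz. The vertices of the simplex give
    f(u, y_i) >= f_i + <gx_i, u - x_i>, while averaging the interpolation
    inequalities with weights [l] and using |gy_i| <= m gives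
    f(x_i, v) <= f_i + <gy_i, v - y_i>. *)

(** * Inner product and Euclidean norm *)

Section EuclideanSpace.
Context {R : realType} {d : nat}.
Implicit Types (u v w : 'rV[R]_d) (a : R).

Lemma dotpC u v : dotp u v = dotp v u.
Proof. by apply: eq_bigr => k _; rewrite mulrC. Qed.

Lemma dotpDr u v w : dotp u (v + w) = dotp u v + dotp u w.
Proof. by rewrite -big_split; apply: eq_bigr => k _; rewrite mxE mulrDr. Qed.

Lemma dotpZr a u v : dotp u (a *: v) = a * dotp u v.
Proof. by rewrite mulr_sumr; apply: eq_bigr => k _; rewrite mxE mulrCA. Qed.

Lemma dotpNr u v : dotp u (- v) = - dotp u v.
Proof. by rewrite -scaleN1r dotpZr mulN1r. Qed.

Lemma dotpBr u v w : dotp u (v - w) = dotp u v - dotp u w.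
Proof. by rewrite dotpDr dotpNr. Qed.

Lemma dotp0r u : dotp u 0 = 0.
Proof. by rewrite -(scale0r 0) dotpZr mul0r. Qed.

Lemma dotp_sumr (I : finType) u (F : I -> 'rV[R]_d) :
  dotp u (\sum_i F i) = \sum_i dotp u (F i).
Proof. exact: (big_morph (dotp u) (dotpDr u) (dotp0r u)). Qed.

Lemma dotp_ge0 u : 0 <= dotp u u.
Proof. by apply: sumr_ge0 => k _; rewrite -expr2 sqr_ge0. Qed.

Lemma norm2_ge0 u : 0 <= norm2 u.
Proof. exact: sqrtr_ge0. Qed.

Lemma sqr_norm2 u : norm2 u ^+ 2 = dotp u u.
Proof. exact: sqr_sqrtr (dotp_ge0 u). Qed.

Lemma norm2Z a u : norm2 (a *: u) = `|a| * norm2 u.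
Proof.
rewrite /norm2 dotpZr dotpC dotpZr mulrA -expr2 sqrtrM ?sqr_ge0 //.
by rewrite sqrtr_sqr.
Qed.

Lemma norm2N u : norm2 (- u) = norm2 u.
Proof. by rewrite -scaleN1r norm2Z normrN1 mul1r. Qed.

Lemma norm20 : norm2 (0 : 'rV[R]_d) = 0.
Proof. by rewrite /norm2 dotp0r sqrtr0. Qed.

Lemma norm2_eq0 u : norm2 u = 0 -> u = 0.
Proof.
move=> u0; have /eqP : dotp u u = 0 by rewrite -sqr_norm2 u0 expr0n.
rewrite psumr_eq0 => [/allP uk0|k _]; last by rewrite -expr2 sqr_ge0.
apply/rowP => k; have := uk0 k (mem_index_enum k).
by rewrite -expr2 sqrf_eq0 mxE => /eqP.
Qed.

(** Cauchy-Schwarz: the square of [norm2 v *: u - norm2 u *: v] is nonnegative and factors as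
    [2 * (a * b) * (a * b - s)]; zero vectors are treated apart so that [a * b] can be cancelled. *)
Lemma dotp_le_norm2 u v : dotp u v <= norm2 u * norm2 v.
Proof.
have [/norm2_eq0 -> | u0] := eqVneq (norm2 u) 0.
  by rewrite dotpC dotp0r norm20 mul0r.
have [/norm2_eq0 -> | v0] := eqVneq (norm2 v) 0.
  by rewrite dotp0r norm20 mulr0.
have := dotp_ge0 (norm2 v *: u - norm2 u *: v).
rewrite dotpBr !dotpZr ![dotp (_ - _) _]dotpC !dotpBr !dotpZr.
rewrite (dotpC v u) -!sqr_norm2.
set s := dotp u v; set a := norm2 u in u0 *; set b := norm2 v in v0 *.
have -> : b * (b * a ^+ 2 - a * s) - a * (b * s - a * b ^+ 2) =
  (a * b) * (2 * (a * b - s)) by ring.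
have ab0 : 0 < a * b by rewrite mulr_gt0 // lt_def norm2_ge0 ?u0 ?v0.
by rewrite pmulr_rge0 // pmulr_rge0 // subr_ge0.
Qed.

Lemma norm2D u v : norm2 (u + v) <= norm2 u + norm2 v.
Proof.
rewrite -(ler_pXn2r (ltn0Sn 1)) ?nnegrE ?addr_ge0 ?norm2_ge0 //.
rewrite sqrrD !sqr_norm2 dotpDr ![dotp (u + v) _]dotpC !dotpDr (dotpC v u).
have := dotp_le_norm2 u v; lra.
Qed.

End EuclideanSpace.

(** * The interpolating saddle function *)

Section Envelope.
Context {R : realType} {dx dy : nat} {I : finType}.
Variables (m : R) (x : I -> 'rV[R]_dx) (y : I -> 'rV[R]_dy)
  (gx : I -> 'rV[R]_dx) (fv : I -> R).
Implicit Types (l : I -> R) (u : 'rV[R]_dx) (v : 'rV[R]_dy).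

Definition simplex l : Prop := (forall i, 0 <= l i) /\ \sum_i l i = 1.

Definition vertex (i : I) : I -> R := fun j => (j == i)%:R.

Definition tangent (i : I) u : R := fv i + dotp (gx i) (u - x i).

(** The norm term is a penalty in place of the constraint that the weighted mean of the [y i] equals
    [v], so every [l] in the simplex is admissible for every [v]. *)
Definition relaxed l u v : R :=
  \sum_i l i * tangent i u - m * norm2 (v - \sum_i l i *: y i).

Definition envelope u v : R := sup [set relaxed l u v | l in simplex]%classic.

Lemma sum_vertex (V : lmodType R) (F : I -> V) i :
  \sum_j vertex i j *: F j = F i.
Proof.
rewrite (bigD1 i) //= /vertex eqxx scale1r big1 ?addr0 // => j /negbTE ->.
by rewrite scale0r.
Qed.

Lemma simplex_vertex i : simplex (vertex i).
Proof.
split=> [j|]; first exact: ler0n.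
by rewrite -[RHS](sum_vertex R^o (fun=> 1) i); apply: eq_bigr => j _;
  rewrite [RHS]mulr1.
Qed.

Lemma simplex_mix t l0 l1 : 0 <= t -> t <= 1 -> simplex l0 -> simplex l1 ->
  simplex (fun i => t * l0 i + (1 - t) * l1 i).
Proof.
move=> t0 t1 [l0_ge0 l0_sum] [l1_ge0 l1_sum]; split=> [i|].
  by rewrite addr_ge0 ?mulr_ge0 ?subr_ge0.
by rewrite big_split /= -!mulr_sumr l0_sum l1_sum !mulr1 subrKC.
Qed.

Lemma simplex_le1 l i : simplex l -> l i <= 1.
Proof.
by case=> l_ge0 <-; rewrite (bigD1 i) //= lerDl sumr_ge0.
Qed.

Lemma relaxed_vertex i u v :
  relaxed (vertex i) u v = tangent i u - m * norm2 (v - y i).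
Proof. by rewrite /relaxed sum_vertex (sum_vertex R^o). Qed.

Hypothesis I_gt0 : (0 < #|I|)%N.

Lemma envelope_le u v c :
  (forall l, simplex l -> relaxed l u v <= c) -> envelope u v <= c.
Proof.
move=> le_c; apply: ge_sup => [|_ [l ls <-]]; last exact: le_c.
(* Bounding a [sup] from above requires a nonempty set; a vertex supplies an element. *)
have [i _] := card_gt0P I_gt0.
by exists (relaxed (vertex i) u v), (vertex i); first exact: simplex_vertex.
Qed.

Hypothesis m_ge0 : 0 <= m.

Lemma relaxed_le_envelope l u v : simplex l -> relaxed l u v <= envelope u v.
Proof.
move=> ls; apply: ub_le_sup; last by exists l.
(* An upper bound independent of the weights: each weight is at most 1 and the penalty only lowers
   the value. *)
exists (\sum_i `|tangent i u|) => _ [l' l's <-].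
rewrite lerBlDr ler_wpDr ?mulr_ge0 ?norm2_ge0 //; apply: ler_sum => i _.
apply: le_trans (ler_norm _) _; rewrite normrM ger0_norm ?(proj1 l's) //.
by rewrite ler_piMl // simplex_le1.
Qed.

(** * Convexity in the first variable, concavity in the second *)

Lemma relaxed_convex l t u0 u1 v :
  relaxed l (t *: u0 + (1 - t) *: u1) v =
  t * relaxed l u0 v + (1 - t) * relaxed l u1 v.
Proof.
rewrite /relaxed.
suff -> : \sum_i l i * tangent i (t *: u0 + (1 - t) *: u1) =
    t * (\sum_i l i * tangent i u0) + (1 - t) * (\sum_i l i * tangent i u1).
  by ring.
rewrite !mulr_sumr -big_split; apply: eq_bigr => i _ /=.
by rewrite /tangent !dotpBr dotpDr !dotpZr; ring.
Qed.

(** Joint concavity in [(l, v)]: the first sum is linear in [l], and the penalty is the norm of a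
    vector linear in [(l, v)]. *)
Lemma relaxed_concave t l0 l1 u v0 v1 : 0 <= t -> t <= 1 ->
  t * relaxed l0 u v0 + (1 - t) * relaxed l1 u v1 <=
  relaxed (fun i => t * l0 i + (1 - t) * l1 i) u (t *: v0 + (1 - t) *: v1).
Proof.
move=> t0 t1; rewrite /relaxed.
set z0 := v0 - _; set z1 := v1 - _.
have -> : t *: v0 + (1 - t) *: v1 - \sum_i (t * l0 i + (1 - t) * l1 i) *: y i =
    t *: z0 + (1 - t) *: z1.
  rewrite /z0 /z1 !scalerBr addrACA -opprD; congr (_ - _).
  rewrite !scaler_sumr -big_split; apply: eq_bigr => i _.
  by rewrite scalerDl !scalerA.
have -> : \sum_i (t * l0 i + (1 - t) * l1 i) * tangent i u =
    t * (\sum_i l0 i * tangent i u) + (1 - t) * (\sum_i l1 i * tangent i u).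
  rewrite !mulr_sumr -big_split; apply: eq_bigr => i _ /=; ring.
have := norm2D (t *: z0) ((1 - t) *: z1).
rewrite !norm2Z !ger0_norm ?subr_ge0 // => /(ler_wpM2l m_ge0).
lra.
Qed.

Lemma envelope_concave t u v0 v1 : 0 <= t -> t <= 1 ->
  t * envelope u v0 + (1 - t) * envelope u v1 <=
  envelope u (t *: v0 + (1 - t) *: v1).
Proof.
move=> t0 t1; set c := envelope u (_ + _).
have le_c l0 l1 : simplex l0 -> simplex l1 ->
    t * relaxed l0 u v0 + (1 - t) * relaxed l1 u v1 <= c.
  move=> s0 s1; apply: le_trans (relaxed_concave t l0 l1 u v0 v1 t0 t1) _.
  exact: relaxed_le_envelope (simplex_mix t l0 l1 t0 t1 s0 s1).
(* Passes to the supremum in one summand while the other is frozen in [b]; used once for each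
   endpoint. The case [s = 0] is separate because the proof divides by [s]. *)
have le_env (s a b : R) (v : 'rV[R]_dy) : 0 <= s ->
    (forall l, simplex l -> s * relaxed l u v + b <= a) ->
    s * envelope u v + b <= a.
  rewrite le_eqVlt => /predU1P[<- le_a|s0 le_a].
    have [i _] := card_gt0P I_gt0.
    by have := le_a _ (simplex_vertex i); rewrite !mul0r.
  rewrite -lerBrDr -ler_pdivlMl //; apply: envelope_le => l ls.
  by rewrite ler_pdivlMl // lerBrDr le_a.
apply: (le_env) => // l0 s0; rewrite addrC; apply: (le_env) => [|l1 s1].
  by rewrite subr_ge0.
by rewrite addrC le_c.
Qed.

Lemma envelope_convex t u0 u1 v : 0 <= t -> t <= 1 ->
  envelope (t *: u0 + (1 - t) *: u1) v <=
  t * envelope u0 v + (1 - t) * envelope u1 v.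
Proof.
move=> t0 t1; apply: envelope_le => l ls; rewrite relaxed_convex.
by rewrite lerD ?ler_wpM2l ?subr_ge0 ?relaxed_le_envelope.
Qed.

Lemma envelope_convex_concave : convex_concave envelope.
Proof.
split=> [v|u] t a b _ _.
  by apply: envelope_convex; [exact: ge0 | exact: le1].
rewrite convRE !mulrN -opprD lerN2.
by apply: envelope_concave; [exact: ge0 | exact: le1].
Qed.

(** * Lipschitz bound *)

Hypothesis gx_le : forall i, norm2 (gx i) <= m.

(** With [l] fixed, the slope in [u] is an average of the [gx i], and the penalty varies in [v] by
    the triangle inequality. *)
Lemma relaxed_lip l u0 u1 v0 v1 : simplex l ->
  relaxed l u1 v1 <= relaxed l u0 v0 + m * (norm2 (u1 - u0) + norm2 (v1 - v0)).
Proof.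
move=> [l_ge0 l_sum]; rewrite /relaxed.
set z := \sum_i l i *: y i.
have x_lip : \sum_i l i * tangent i u1 <=
    \sum_i l i * tangent i u0 + m * norm2 (u1 - u0).
  rewrite -[X in _ + X]mul1r -l_sum mulr_suml -big_split.
  apply: ler_sum => i _ /=.
  rewrite -mulrDr ler_wpM2l // /tangent -addrA lerD2l.
  have -> : u1 - x i = (u0 - x i) + (u1 - u0) by rewrite [X in _ = X]addrC subrKA.
  rewrite dotpDr lerD2l; apply: le_trans (dotp_le_norm2 _ _) _.
  by rewrite ler_wpM2r ?norm2_ge0.
have /(ler_wpM2l m_ge0) : norm2 (v0 - z) <= norm2 (v1 - z) + norm2 (v1 - v0).
  rewrite -(norm2N (v1 - v0)) opprB; apply: le_trans (norm2D _ _).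
  by rewrite [v1 - z + _]addrC subrKA.
lra.
Qed.

Lemma envelope_lip u0 u1 v0 v1 :
  `|envelope u1 v1 - envelope u0 v0| <=
  m * (norm2 (u1 - u0) + norm2 (v1 - v0)).
Proof.
have half a b c e : envelope a c <=
    envelope b e + m * (norm2 (a - b) + norm2 (c - e)).
  apply: envelope_le => l ls; apply: le_trans (relaxed_lip l b a e c ls) _.
  by rewrite lerD2r relaxed_le_envelope.
have := half u1 u0 v1 v0; have := half u0 u1 v0 v1.
rewrite -(norm2N (u1 - u0)) -(norm2N (v1 - v0)) !opprB ler_norml.
lra.
Qed.

(** * Interpolation of the data *)

Variable gy : I -> 'rV[R]_dy.
Hypothesis gy_le : forall i, norm2 (gy i) <= m.
Hypothesis compat : forall i j,
  fv j + dotp (gx j) (x i - x j) + dotp (gy i) (y i - y j) <= fv i.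

Lemma envelope_le_cotangent i v :
  envelope (x i) v <= fv i + dotp (gy i) (v - y i).
Proof.
apply: envelope_le => l [l_ge0 l_sum]; rewrite /relaxed.
set z := \sum_i l i *: y i.
(* The average of [compat i j] over [j] with weights [l]: an affine function of [y j] averages to
   its value at the mean [z]. *)
have le_z : \sum_j l j * tangent j (x i) <= fv i + dotp (gy i) (z - y i).
  have -> : fv i + dotp (gy i) (z - y i) =
      \sum_j l j * (fv i + dotp (gy i) (y j - y i)).
    under [RHS]eq_bigr => j _ do rewrite dotpBr addrCA mulrDr -dotpZr.
    by rewrite big_split /= -dotp_sumr -mulr_suml l_sum mul1r dotpBr addrCA.
  apply: ler_sum => j _; rewrite ler_wpM2l //.
  have := compat i j; rewrite /tangent !dotpBr; lra.
(* The penalty pays for replacing [z] by [v]. *)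
have : dotp (gy i) (z - v) <= m * norm2 (v - z).
  rewrite -(norm2N (v - z)) opprB; apply: le_trans (dotp_le_norm2 _ _) _.
  by rewrite ler_wpM2r ?norm2_ge0.
move: le_z; rewrite !dotpBr; lra.
Qed.

(** At the vertex [i] the penalty vanishes when [v = y i]. *)
Lemma tangent_le_envelope i u : tangent i u <= envelope u (y i).
Proof.
have := relaxed_le_envelope (vertex i) u (y i) (simplex_vertex i).
by rewrite relaxed_vertex subrr norm20 mulr0 subr0.
Qed.

Lemma envelope_interpolates i : envelope (x i) (y i) = fv i.
Proof.
apply: le_anti; have := envelope_le_cotangent i (y i).
have := tangent_le_envelope i (x i).
by rewrite /tangent !subrr !dotp0r !addr0 => -> ->.
Qed.

End Envelope.

(** * Gradient bounds from the Lipschitz condition, and the equivalence *)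

Lemma subgradient_norm2_le (R : realType) (d : nat) (f : 'rV[R]_d -> R)
    (u g : 'rV[R]_d) (m : R) : 0 <= m -> subdifferential f u g ->
  (forall v, f v - f u <= m * norm2 (v - u)) -> norm2 g <= m.
Proof.
move=> m_ge0 fg f_lip; have [->|g0] := eqVneq (norm2 g) 0; first by [].
have g_gt0 : 0 < norm2 g by rewrite lt_def g0 norm2_ge0.
rewrite -(ler_pM2r g_gt0) -expr2 sqr_norm2.
(* Moving from [u] by [g] itself makes the subgradient inequality give the square of [norm2 g] as a
   lower bound on the increase. *)
have := fg (u + g); have := f_lip (u + g); rewrite [u + g - u]addrC addKr; lra.
Qed.

Lemma supergradient_norm2_le (R : realType) (d : nat) (f : 'rV[R]_d -> R)
    (u g : 'rV[R]_d) (m : R) : 0 <= m -> superdifferential f u g ->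
  (forall v, f u - f v <= m * norm2 (v - u)) -> norm2 g <= m.
Proof.
move=> m_ge0 fg f_lip; rewrite -norm2N.
apply: (subgradient_norm2_le _ _ (fun v => - f v) u) => // v.
  have := fg v; rewrite /= (dotpC (- g)) dotpNr (dotpC (v - u)); lra.
have := f_lip v; lra.
Qed.

Theorem theorem3p2 (R : realType) (dx dy : nat) (M : \bar R)
    (hM : (0 <= M)%E) (I : finType) (hI : (0 < #|I|)%N)
    (x : I -> 'rV[R]_dx) (y : I -> 'rV[R]_dy)
    (gx : I -> 'rV[R]_dx) (gy : I -> 'rV[R]_dy) (fv : I -> R) :
  interpolable (lip_convex_concave M) x y gx gy fv <->
  (forall i j : I,
      fv i >= fv j + dotp (gx j) (x i - x j) + dotp (gy i) (y i - y j)) /\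
  (forall i : I, ((norm2 (gx i))%:E <= M)%E /\ ((norm2 (gy i))%:E <= M)%E).
Proof.
split=> [[f [[_ f_lip] f_int]]|[compat g_le]].
  split=> [i j|i].
    have [_ fy ->] := f_int i; have [fx _ ->] := f_int j.
    (* Both inequalities meet at the mixed point [(x i, y j)], whose value cancels. *)
    have := fx (x i); have := fy (y j); rewrite !dotpBr; lra.
  have [fx fy _] := f_int i; move: M hM f_lip => [r|_ _|//]; last first.
    by rewrite !leey.
  rewrite !lee_fin => r_ge0 f_lip; split.
    apply: (subgradient_norm2_le _ _ _ _ _ _ r_ge0 fx) => u.
    have := f_lip (x i) u (y i) (y i).
    rewrite subrr norm20 addr0 lee_fin; exact/le_trans/ler_norm.
  apply: (supergradient_norm2_le _ _ _ _ _ _ r_ge0 fy) => v.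
  have := f_lip (x i) (x i) (y i) v.
  rewrite subrr norm20 add0r lee_fin distrC; exact/le_trans/ler_norm.
(* A finite constant for the envelope: [M] itself when finite, otherwise the sum of all gradient
   norms. *)
have [m [m_ge0 m_le gx_le gy_le]] : exists m : R,
    [/\ 0 <= m, (m%:E <= M)%E, forall i, norm2 (gx i) <= m &
        forall i, norm2 (gy i) <= m].
  move: M hM g_le => [r|_ _|//]; last first.
    have sum_ge0 (P : pred I) : 0 <= \sum_(i | P i) (norm2 (gx i) + norm2 (gy i)).
      by apply: sumr_ge0 => i _; rewrite addr_ge0 ?norm2_ge0.
    exists (\sum_i (norm2 (gx i) + norm2 (gy i))).
    split=> [||i|i]; rewrite ?leey // (bigD1 i) //= -addrA.
      by rewrite lerDl addr_ge0 ?norm2_ge0.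
    by rewrite addrCA lerDl addr_ge0 ?norm2_ge0.
  rewrite lee_fin => r_ge0 g_le; exists r; split=> // i.
    by have [] := g_le i; rewrite !lee_fin.
  by have [] := g_le i; rewrite !lee_fin.
exists (envelope m x y gx fv); split=> [|i].
  split; first exact: envelope_convex_concave.
  move=> x0 x1 y0 y1; apply: le_trans (lee_wpmul2r _ m_le); last first.
    by rewrite lee_fin addr_ge0 ?norm2_ge0.
  by rewrite -EFinM lee_fin; apply: envelope_lip.
have env_i := envelope_interpolates m x y gx fv hI m_ge0 gy gy_le compat i.
split=> [u|v|]; rewrite ?env_i //.
  exact: tangent_le_envelope.
exact: envelope_le_cotangent.
Qed.
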